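(* Let $\Omega$ be an infinite set, and let $J$ be any set of cardinality $\le\mathrm{card}(\Omega)$. Let $L$ denote the lattice of solution sets in $\mathrm{Sym}(\Omega)^J\times\mathrm{Rel}(\Omega)$ of systems of equations in a $J$-tuple of $\mathrm{Sym}(\Omega)$-valued variables, and a single $\mathrm{Rel}(\Omega)$-valued variable which appears at most once on each side of any equation, together with arbitrary $\mathrm{Sym}(\Omega)$-valued constants. Let $L'$ similarly denote the lattice of solution sets in $\mathrm{Sym}(\Omega)^J$ of systems of equations having on each side a word in a $J$-tuple of $\mathrm{Sym}(\Omega)$-valued variables, arbitrary $\mathrm{Sym}(\Omega)$-valued constants, and at most one occurrence of a $\mathrm{Rel}(\Omega)$-valued constant. Then neither of these lattices contains a chain with $>\mathrm{card}(\Omega)$ jumps. Hence for any monoid $M$ embeddable in $\mathrm{Rel}(\Omega)$, the corresponding restrictions hold, with the group $U(M)$ of invertible elements of $M$ taking the place of $\mathrm{Sym}(\Omega)$ (and $M$ that of $\mathrm{Rel}(\Omega)$).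
   Context: $\mathrm{Rel}(\Omega)$ is the monoid of all binary relations on $\Omega$ (subsets of $\Omega\times\Omega$) under the composition $xy=\{(q,p)\mid(\exists r\in\Omega)\ (q,r)\in x,\ (r,p)\in y\}$, with the diagonal as identity. A function $f:\Omega\to\Omega$ is identified with the relation $\{(f(p),p)\mid p\in\Omega\}$; thus the symmetric group $\mathrm{Sym}(\Omega)$ of all permutations of $\Omega$ is the group of invertible elements of $\mathrm{Rel}(\Omega)$. A ''$\mathrm{Sym}(\Omega)$-valued variable'' ranges over $\mathrm{Sym}(\Omega)$ and a ''$\mathrm{Rel}(\Omega)$-valued variable'' over all of $\mathrm{Rel}(\Omega)$; a ''$\mathrm{Rel}(\Omega)$-valued constant'' is any fixed element of $\mathrm{Rel}(\Omega)$. The two sides of the equations are words formed using the monoid multiplication, where inverses of $\mathrm{Sym}(\Omega)$-valued variables and constants may also be used. A system of equations is an arbitrary (possibly infinite) set of such equations, and solution sets are ordered by inclusion. Thus, e.g., for a monoid $M$ the analog of $L$ consists of subsets of $U(M)^J\times M$ and the analog of $L'$ of subsets of $U(M)^J$. A chain is a totally ordered subset. A jump in a totally ordered set $C$ is a pair $x<y$ in $C$ such that no $z\in C$ satisfies $x<z<y$. Monoid embeddings preserve the identity element. *)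

(* Defs.v *)
From HB Require Import structures.
From mathcomp Require Import all_boot.
From mathcomp Require Import boolp classical_sets functions cardinality.
From mathcomp Require Import monoid.

Set Implicit Arguments.
Unset Strict Implicit.
Unset Printing Implicit Defensive.

Local Open Scope classical_set_scope.
Local Open Scope card_scope.
Local Open Scope group_scope.

Definition Rel (Omega : Type) : Type := set (Omega * Omega).

HB.instance Definition _ (Omega : Type) :=
  Choice.copy (Rel Omega) (set (Omega * Omega)).

Definition rel_comp (Omega : Type) (x y : Rel Omega) : Rel Omega :=
  [set qp | exists r : Omega, x (qp.1, r) /\ y (r, qp.2)].

Definition rel_id (Omega : Type) : Rel Omega := diagonal.

Lemma rel_compA (Omega : Type) : associative (@rel_comp Omega).
Proof.
move=> x y z; apply/seteqP; split=> -[q p] /=.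
- by move=> [r [xqr [s [yrs zsp]]]]; exists s; split=> //; exists r.
- by move=> [s [[r [xqr yrs]] zsp]]; exists r; split=> //; exists s.
Qed.

Lemma rel_comp1x (Omega : Type) :
  left_id (@rel_id Omega) (@rel_comp Omega).
Proof.
move=> x; apply/seteqP; split=> -[q p] /=; last by exists q.
by move=> [r [/= qr xrp]]; rewrite [q]qr.
Qed.

Lemma rel_compx1 (Omega : Type) :
  right_id (@rel_id Omega) (@rel_comp Omega).
Proof.
move=> x; apply/seteqP; split=> -[q p] /=; last by exists p.
by move=> [r [/= xqr rp]]; rewrite -[p]rp.
Qed.

HB.instance Definition _ (Omega : Type) :=
  isMonoid.Build (Rel Omega) (@rel_compA Omega)
    (@rel_comp1x Omega) (@rel_compx1 Omega).

(* The inverse is stored as data; it is determined by the permutation. *)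
Record Sym (Omega : Type) : Type := MkSym {
  sym_fun :> Omega -> Omega;
  sym_fun_inv : Omega -> Omega;
  sym_funK : cancel sym_fun sym_fun_inv;
  sym_funVK : cancel sym_fun_inv sym_fun
}.

Lemma sym_eq (Omega : Type) (s t : Sym Omega) : s =1 t -> s = t.
Proof.
case: s t => [f f' fK f'K] [g g' gK g'K] /= /funext fg.
move: fK f'K; rewrite fg => fK f'K.
have fg' : f' = g' by apply/funext => a; rewrite -{1}[a]g'K fK.
move: fK f'K; rewrite fg' => fK f'K.
by congr MkSym; apply: Prop_irrelevance.
Qed.

HB.instance Definition _ (Omega : Type) := gen_eqMixin (Sym Omega).
HB.instance Definition _ (Omega : Type) := gen_choiceMixin (Sym Omega).

Definition sym_one (Omega : Type) : Sym Omega :=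
  @MkSym Omega id id (fun=> erefl) (fun=> erefl).

Definition sym_inv (Omega : Type) (s : Sym Omega) : Sym Omega :=
  MkSym (sym_funVK s) (sym_funK s).

Definition sym_mul (Omega : Type) (s t : Sym Omega) : Sym Omega :=
  MkSym (can_comp (sym_funK s) (sym_funK t))
        (can_comp (sym_funVK t) (sym_funVK s)).

Lemma sym_mulA (Omega : Type) : associative (@sym_mul Omega).
Proof. by move=> s t u; apply: sym_eq. Qed.

Lemma sym_mul1s (Omega : Type) :
  left_id (@sym_one Omega) (@sym_mul Omega).
Proof. by move=> s; apply: sym_eq. Qed.

Lemma sym_muls1 (Omega : Type) :
  right_id (@sym_one Omega) (@sym_mul Omega).
Proof. by move=> s; apply: sym_eq. Qed.

Lemma sym_mulVs (Omega : Type) :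
  left_inverse (@sym_one Omega) (@sym_inv Omega) (@sym_mul Omega).
Proof. by move=> s; apply: sym_eq => a /=; rewrite sym_funK. Qed.

Lemma sym_mulsV (Omega : Type) :
  right_inverse (@sym_one Omega) (@sym_inv Omega) (@sym_mul Omega).
Proof. by move=> s; apply: sym_eq => a /=; rewrite sym_funVK. Qed.

HB.instance Definition _ (Omega : Type) :=
  isGroup.Build (Sym Omega) (@sym_mulA Omega) (@sym_mul1s Omega)
    (@sym_muls1 Omega) (@sym_mulVs Omega) (@sym_mulsV Omega).

(* A function f is identified with {(f p, p)}: the value comes first, so that
   composition of relations extends composition of functions. *)
Definition rel_of_fun (Omega : Type) (f : Omega -> Omega) : Rel Omega :=
  [set qp | qp.1 = f qp.2].

Definition rel_of_sym (Omega : Type) (s : Sym Omega) : Rel Omega :=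
  rel_of_fun s.

Lemma rel_of_sym_morphism (Omega : Type) : monoid_morphism (@rel_of_sym Omega).
Proof.
split=> [//|s t]; apply/seteqP; split=> -[q p] /=.
- by move=> qE; exists (t p).
- by move=> [r [qr rp]]; rewrite [q]qr [r in sym_fun s r]rp.
Qed.

Record Units (M : monoidType) : Type := MkUnits {
  uval :> M;
  uval_inv : M;
  uval_mulV : uval * uval_inv = 1;
  uval_Vmul : uval_inv * uval = 1
}.

Lemma units_eq (M : monoidType) (u v : Units M) : uval u = uval v -> u = v.
Proof.
case: u v => [a a' aa' a'a] [b b' bb' b'b] /= ab.
move: aa' a'a; rewrite ab => aa' a'a.
have ab' : a' = b' by rewrite -[a']mulg1 -bb' mulgA a'a mul1g.
move: aa' a'a; rewrite ab' => aa' a'a.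
by congr MkUnits; apply: Prop_irrelevance.
Qed.

HB.instance Definition _ (M : monoidType) := gen_eqMixin (Units M).
HB.instance Definition _ (M : monoidType) := gen_choiceMixin (Units M).

Definition units_one (M : monoidType) : Units M :=
  MkUnits (mulg1 (1 : M)) (mulg1 (1 : M)).

Definition units_inv (M : monoidType) (u : Units M) : Units M :=
  MkUnits (uval_Vmul u) (uval_mulV u).

Lemma units_mul_subproof (M : monoidType) (a a' b b' : M) :
  a * a' = 1 -> b * b' = 1 -> (a * b) * (b' * a') = 1.
Proof. by move=> aa' bb'; rewrite -mulgA (mulgA b) bb' mul1g. Qed.

Definition units_mul (M : monoidType) (u v : Units M) : Units M :=
  MkUnits (units_mul_subproof (uval_mulV u) (uval_mulV v))
          (units_mul_subproof (uval_Vmul v) (uval_Vmul u)).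

Lemma units_mulA (M : monoidType) : associative (@units_mul M).
Proof. by move=> u v w; apply: units_eq; apply: mulgA. Qed.

Lemma units_mul1u (M : monoidType) : left_id (@units_one M) (@units_mul M).
Proof. by move=> u; apply: units_eq; apply: mul1g. Qed.

Lemma units_mulu1 (M : monoidType) : right_id (@units_one M) (@units_mul M).
Proof. by move=> u; apply: units_eq; apply: mulg1. Qed.

Lemma units_mulVu (M : monoidType) :
  left_inverse (@units_one M) (@units_inv M) (@units_mul M).
Proof. by move=> u; apply: units_eq; apply: uval_Vmul. Qed.

Lemma units_muluV (M : monoidType) :
  right_inverse (@units_one M) (@units_inv M) (@units_mul M).
Proof. by move=> u; apply: units_eq; apply: uval_mulV. Qed.

HB.instance Definition _ (M : monoidType) :=
  isGroup.Build (Units M) (@units_mulA M) (@units_mul1u M)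
    (@units_mulu1 M) (@units_mulVu M) (@units_muluV M).

Lemma uval_morphism (M : monoidType) : monoid_morphism (@uval M).
Proof. by []. Qed.

Lemma rel_of_sym_units (Omega : Type) :
  range (@rel_of_sym Omega) = range (@uval (Rel Omega)).
Proof.
apply/seteqP; split=> x /=.
- move=> [s _ <-].
  have sV : rel_of_sym s * rel_of_sym s^-1 = 1.
    by rewrite -(rel_of_sym_morphism Omega).2 mulgV (rel_of_sym_morphism Omega).1.
  have Vs : rel_of_sym s^-1 * rel_of_sym s = 1.
    by rewrite -(rel_of_sym_morphism Omega).2 mulVg (rel_of_sym_morphism Omega).1.
  by exists (MkUnits sV Vs).
move=> [[y y' yy' y'y] _ /= <-].
have D (z z' : Rel Omega) : z * z' = 1 ->
    forall q, exists r, z (q, r) /\ z' (r, q).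
  by move=> zz' q; have : (z * z')%g (q, q) by rewrite zz'.
have E (z z' : Rel Omega) : z * z' = 1 ->
    forall q r p, z (q, r) -> z' (r, p) -> q = p.
  move=> zz' q r p zqr z'rp.
  have : (z * z')%g (q, p) by exists r.
  by rewrite zz'.
have [f fP] := choice (D _ _ y'y).
have [g gP] := choice (D _ _ yy').
have fK : cancel f g.
  move=> p; apply/esym; apply: (E _ _ y'y _ (f p)).
    by case: (fP p).
  by case: (gP (f p)).
have gK : cancel g f.
  move=> p; apply/esym; apply: (E _ _ yy' _ (g p)).
    by case: (gP p).
  by case: (fP (g p)).
exists (MkSym fK gK) => //.
apply/seteqP; split=> -[q p] /=.
- by move=> qE; rewrite [q]qE; case: (fP p).
- by move=> yqp; apply: (E _ _ yy' _ p) => //; case: (fP p).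
Qed.

(* Letters of a word: variables and constants from a group G, each possibly
   inverted, and M-valued symbols from A.  For one M-valued variable take
   A := unit; for arbitrary M-valued constants take A := M. *)
Inductive letter (J G A : Type) : Type :=
  | GVar of J
  | GVarInv of J
  | GCst of G
  | GCstInv of G
  | MSym of A.

Arguments GVar {J G A}.
Arguments GVarInv {J G A}.
Arguments GCst {J G A}.
Arguments GCstInv {J G A}.
Arguments MSym {J G A}.

Definition word (J G A : Type) : Type := seq (letter J G A).

Definition is_MSym (J G A : Type) (l : letter J G A) : bool :=
  if l is MSym _ then true else false.

Definition equation (J G A : Type) : Type := (word J G A * word J G A)%type.

Definition MSym_at_most_once (J G A : Type) (e : equation J G A) : Prop :=
  (count (@is_MSym J G A) e.1 <= 1)%N /\ (count (@is_MSym J G A) e.2 <= 1)%N.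

Definition eval_letter (J : Type) (G : groupType) (M : monoidType) (A : Type)
    (i : G -> M) (x : J -> G) (v : A -> M) (l : letter J G A) : M :=
  match l with
  | GVar j => i (x j)
  | GVarInv j => i (x j)^-1
  | GCst c => i c
  | GCstInv c => i c^-1
  | MSym a => v a
  end.

Definition eval_word (J : Type) (G : groupType) (M : monoidType) (A : Type)
    (i : G -> M) (x : J -> G) (v : A -> M) (w : word J G A) : M :=
  foldr (fun l m => eval_letter i x v l * m) 1 w.

Definition satisfies (J : Type) (G : groupType) (M : monoidType) (A : Type)
    (i : G -> M) (x : J -> G) (v : A -> M) (S : set (equation J G A)) : Prop :=
  forall e, S e -> eval_word i x v e.1 = eval_word i x v e.2.

Definition lattice_L (J : Type) (G : groupType) (M : monoidType)
    (i : G -> M) : set (set ((J -> G) * M)) :=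
  [set X | exists S : set (equation J G unit),
     (forall e, S e -> MSym_at_most_once e) /\
     X = [set xy | satisfies i xy.1 (fun=> xy.2) S]].

Definition lattice_L' (J : Type) (G : groupType) (M : monoidType)
    (i : G -> M) : set (set (J -> G)) :=
  [set X | exists S : set (equation J G M),
     (forall e, S e -> MSym_at_most_once e) /\
     X = [set x | satisfies i x id S]].

Arguments lattice_L J {G M} i.
Arguments lattice_L' J {G M} i.

Definition chain_in (T : Type) (L C : set (set T)) : Prop :=
  C `<=` L /\ total_on C subset.

Definition jumps (T : Type) (C : set (set T)) : set (set T * set T) :=
  [set XY | [/\ C XY.1, C XY.2, XY.1 `<` XY.2 &
              ~ exists Z, [/\ C Z, XY.1 `<` Z & Z `<` XY.2]]].

(* By the comparability of cardinals, "not more than card Omega jumps" is the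
   existence of an injection of the set of jumps into Omega. *)
Definition no_chain_with_more_jumps (Omega T : Type) (L : set (set T)) : Prop :=
  forall C : set (set T), chain_in L C -> jumps C #<= [set: Omega].

Arguments no_chain_with_more_jumps Omega {T} L.

Definition embeddable (M N : monoidType) : Prop :=
  exists f : M -> N, injective f /\ monoid_morphism f.

(* Main.v *)
(* Write K for the type of all atomic questions "does the relation of the j-th
   variable (or of the Rel-valued variable) contain (q, p)?".  An equation
   compares two relations pair by pair, and whether (q, p) belongs to the value
   of a word with at most one non-invertible letter depends on finitely many
   atoms: reading the word from the ends towards that letter, permutations move
   q and p to determined points.  Hence solution sets are closed for the topology
   generated by K, whose basic open sets are indexed by seq (K * bool), a type
   of cardinality at most card Omega.  Each jump X < Y of a chain of closed sets
   has a basic open set that meets Y and avoids X, and different jumps have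
   different ones.  The cardinal bound rests on Hessenberg's theorem that an
   infinite set is equipotent with its square, proved by Zorn's lemma. *)
Require Import Defs.
From mathcomp Require Import all_boot.
From mathcomp Require Import boolp classical_sets functions cardinality.
From mathcomp Require Import monoid.

Set Implicit Arguments.
Unset Strict Implicit.
Unset Printing Implicit Defensive.

Local Open Scope classical_set_scope.
Local Open Scope card_scope.

(** * Comparability of cardinals *)

Lemma total_on_common (T : Type) (F : set (set T)) (x y : T) :
  total_on F subset -> (\bigcup_(X in F) X) x -> (\bigcup_(X in F) X) y ->
  exists X, [/\ F X, X x & X y].
Proof.
move=> Ftot [X FX Xx] [Y FY Yy].
by have [XY|YX] := Ftot _ _ FX FY; [exists Y|exists X]; split=> //; auto.
Qed.

(** A maximal graph of a partial injection from [A] to [B] is total or onto: otherwise an unmatched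
    [a] and an unmatched [b] could be added as a new pair. *)
Lemma card_le_total (T U : Type) (A : set T) (B : set U) :
  A #<= B \/ B #<= A.
Proof.
elim/Ppointed: T => T in A *; first by left; exact: card_le_emptyl.
elim/Ppointed: U => U in B *; first by right; exact: card_le_emptyl.
pose P (G : set (T * U)) := [/\ G `<=` A `*` B,
  forall a b b', G (a, b) -> G (a, b') -> b = b' &
  forall a a' b, G (a, b) -> G (a', b) -> a = a'].
have [F FP Ftot|G [[GAB Gfun Ginj] Gmax]] := @Zorn_bigcup _ P.
  split=> [x [X /FP[+ _ _]]||]; first exact.
  - move=> a b b' Fb Fb'.
    by have [X [/FP[_ + _]]] := total_on_common Ftot Fb Fb'; apply.
  - move=> a a' b Fa Fa'.
    by have [X [/FP[_ _ +]]] := total_on_common Ftot Fa Fa'; apply.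
have [domA|/existsNP[a /not_implyP[Aa domNa]]] :=
  pselect (forall a, A a -> exists b, G (a, b)).
  left; have [f fP] : {f : T -> U & forall a, A a -> G (a, f a)}.
    apply: (@choice _ _ (fun a b => A a -> G (a, b))) => a.
    have [/domA[b Gab]|NAa] := pselect (A a); first by exists b.
    by exists point.
  apply/pcard_leP/injfunPex; exists f => [a /fP/GAB[]//|].
  move=> a a' /set_mem/fP Ga /set_mem/fP Ga' faa'.
  by apply: (Ginj _ _ (f a)) => //; rewrite faa'.
have [ranB|/existsNP[b /not_implyP[Bb ranNb]]] :=
  pselect (forall b, B b -> exists a, G (a, b)).
  right; have [f fP] : {f : U -> T & forall b, B b -> G (f b, b)}.
    apply: (@choice _ _ (fun b a => B b -> G (a, b))) => b.
    have [/ranB[a' Gab]|NBb] := pselect (B b); first by exists a'.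
    by exists point.
  apply/pcard_leP/injfunPex; exists f => [b /fP/GAB[]//|].
  move=> b b' /set_mem/fP Gb /set_mem/fP Gb' fbb'.
  by apply: (Gfun (f b)) => //; rewrite fbb'.
exfalso; apply: (Gmax (G `|` [set (a, b)])).
  split=> [|sub]; first exact: subsetUl.
  by apply: domNa; exists b; apply: sub; right.
split=> [x [/GAB//|->//]||].
- move=> c d d' [Gcd|[-> ->]]; last by case=> [Gad'|[]//]; case: domNa; exists d'.
  by case=> [/(Gfun _ _ _ Gcd)//|[ca _]]; case: domNa; exists d; rewrite -ca.
- move=> c c' d [Gcd|[-> ->]]; last by case=> [Gc'b|[]//]; case: ranNb; exists c'.
  by case=> [/(Ginj _ _ _ Gcd)//|[_ db]]; case: ranNb; exists c; rewrite -db.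
Qed.


(** * Hessenberg's theorem and injections of finite sequences *)

Section Square.
Variable T : pointedType.
Implicit Types (D : set T) (f : T -> T -> T) (G : set (T * T * T)).

Definition pairing_on D f : Prop :=
  (forall a b, D a -> D b -> D (f a b)) /\
  (forall a b a' b', D a -> D b -> D a' -> D b' ->
     f a b = f a' b' -> a = a' /\ b = b').

Definition pairing_graph D f : set (T * T * T) :=
  [set x | [/\ D x.1.1, D x.1.2 & x.2 = f x.1.1 x.1.2]].

(** Recovers the carrier of a pairing from its graph alone, so that Zorn's lemma applies to sets of
    triples ordered by inclusion. *)
Definition diagonal_domain G : set T := [set a | exists c, G ((a, a), c)].

Definition is_pairing_graph G : Prop :=
  [/\ forall p c c', G (p, c) -> G (p, c') -> c = c',
      forall p p' c, G (p, c) -> G (p', c) -> p = p',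
      forall a b c, G ((a, b), c) ->
        [/\ diagonal_domain G a, diagonal_domain G b & diagonal_domain G c] &
      forall a b, diagonal_domain G a -> diagonal_domain G b ->
        exists c, G ((a, b), c)].

Lemma diagonal_domain_graph D f : diagonal_domain (pairing_graph D f) = D.
Proof.
apply/seteqP; split=> a; first by move=> [c []].
by move=> Da; exists (f a a); split.
Qed.

Lemma pairing_graphP D f :
  pairing_on D f -> is_pairing_graph (pairing_graph D f).
Proof.
move=> [Df finj]; split; rewrite ?diagonal_domain_graph.
- by move=> p c c' [_ _ /= ->] [_ _ /= ->].
- move=> [a b] [a' b'] c [/= Da Db ->] [/= Da' Db'].
  by move=> /(finj _ _ _ _ Da Db Da' Db')[-> ->].
- by move=> a b c [/= Da Db ->]; split=> //; apply: Df.
- by move=> a b Da Db; exists (f a b).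
Qed.

Lemma is_pairing_graph_fun G : is_pairing_graph G ->
  exists2 f, pairing_on (diagonal_domain G) f &
             G = pairing_graph (diagonal_domain G) f.
Proof.
move=> [Gfun Ginj Gdom Gtot]; set D := diagonal_domain G in Gdom Gtot *.
have [f fP] : {f : T * T -> T & forall p, D p.1 -> D p.2 -> G (p, f p)}.
  apply: (@choice _ _ (fun p c => D p.1 -> D p.2 -> G (p, c))) => -[a b] /=.
  have [[Da Db]|NDab] := pselect (D a /\ D b).
    by have [c Gc] := Gtot a b Da Db; exists c.
  by exists point => Da Db; case: NDab.
have fG a b : D a -> D b -> G ((a, b), f (a, b)) by exact: (fP (a, b)).
exists (fun a b => f (a, b)).
  split=> [a b Da Db|a b a' b' Da Db Da' Db' ff'].
    by have [] := Gdom _ _ _ (fG a b Da Db).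
  have := fG a b Da Db; rewrite ff' => /Ginj/(_ (fG a' b' Da' Db')).
  by case.
apply/seteqP; split=> -[[a b] c].
  move=> Gc; have [Da Db _] := Gdom _ _ _ Gc; split=> //=.
  by apply: Gfun Gc _; apply: fG.
by move=> [/= Da Db ->]; apply: fG.
Qed.

Lemma is_pairing_graph_bigcup (F : set (set (T * T * T))) :
  F `<=` is_pairing_graph -> total_on F subset ->
  is_pairing_graph (\bigcup_(G in F) G).
Proof.
move=> FP Ftot.
have domU G a : F G -> diagonal_domain G a ->
    diagonal_domain (\bigcup_(G in F) G) a.
  by move=> FG [c Gc]; exists c; exists G.
split.
- move=> p c c' Fc Fc'.
  have [G [FG Gc Gc']] := total_on_common Ftot Fc Fc'.
  by have [+ _ _ _] := FP _ FG; apply; [exact: Gc|].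
- move=> p p' c Fc Fc'.
  have [G [FG Gc Gc']] := total_on_common Ftot Fc Fc'.
  by have [_ + _ _] := FP _ FG; apply; [exact: Gc|].
- move=> a b c [G FG Gc]; have [_ _ + _] := FP _ FG.
  by move=> /(_ _ _ _ Gc)[Ga Gb Gc']; split; apply: domU FG _.
- move=> a b [c Fc] [d Fd].
  have [G [FG Gc Gd]] := total_on_common Ftot Fc Fd.
  have [_ _ _ +] := FP _ FG.
  move=> /(_ a b (ex_intro _ c Gc) (ex_intro _ d Gd))[e Ge].
  by exists e, G.
Qed.

(* The pairs of [D `|` h @` D] outside [D `*` D] form three copies of [D `*` D];
   [f] and three marks in [D] inject them into [h @` D]. *)
Lemma pairing_on_extend D f (h : T -> T) (t : 'I_3 -> T) :
  pairing_on D f -> injective t -> (forall i, D (t i)) ->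
  (forall a, D a -> ~ D (h a)) -> {in D &, injective h} ->
  exists f', pairing_on (D `|` h @` D) f' /\
    forall a b, D a -> D b -> f' a b = f a b.
Proof.
move=> [Df finj] tinj Dt NDh hinj.
(* [u x] is the base point of [x] in [D]: [x] itself or its preimage under [h]. *)
have [u uP] : {u : T -> T & forall x, (D `|` h @` D) x ->
    D (u x) /\ x = if `[< D x >] then u x else h (u x)}.
  apply: (@choice _ _ (fun x y => (D `|` h @` D) x ->
    D y /\ x = if `[< D x >] then y else h y)) => x.
  have [Dx|NDx] := asboolP (D x); first by exists x.
  have [[y Dy <-]|Nx] := pselect ((h @` D) x); first by exists y.
  by exists x => -[].
(* For pairs outside [D * D] the mark records which coordinates lie in [D]; together with the base
   points it determines the pair. *)
pose k x y : 'I_3 := if `[< D x >] then inord 0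
                     else if `[< D y >] then inord 1 else inord 2.
pose f' x y := if `[< D x /\ D y >] then f x y else
  h (f (t (k x y)) (f (u x) (u y))).
exists f'; split; last first.
  by move=> a b Da Db; rewrite /f' asboolT.
split=> [a b /uP[Da _] /uP[Db _]|a b a' b' /uP[Da aE] /uP[Db bE]
    /uP[Da' a'E] /uP[Db' b'E]].
  rewrite /f'; case: asboolP => [[Da' Db']|_]; first by left; apply: Df.
  by right; exists (f (t (k a b)) (f (u a) (u b))) => //; apply: (Df) => //; apply: Df.
have Dk x y x' y' : D x -> D y -> D (f (t (k x' y')) (f x y)).
  by move=> *; apply: (Df) => //; apply: Df.
rewrite /f'; case: asboolP => [[Da1 Db1]|Nab]; case: asboolP => [[Da2 Db2]|Nab'].
- exact: finj.
- move=> fh; case: (NDh (f (t (k a' b')) (f (u a') (u b')))).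
    exact: Dk.
  by rewrite -fh; apply: Df.
- move=> fh; case: (NDh (f (t (k a b)) (f (u a) (u b)))).
    exact: Dk.
  by rewrite fh; apply: Df.
move=> /hinj; rewrite !inE => /(_ (Dk _ _ _ _ Da Db) (Dk _ _ _ _ Da' Db')).
move=> /finj[]; [by []|exact: Df|by []|exact: Df|].
move=> /tinj kE /finj[]// ua ub.
move: kE aE bE a'E b'E; rewrite /k ua ub.
by do 4 case: asboolP => ?; move=> /(congr1 val); rewrite /= ?inordK//;
  move=> _ aE bE a'E b'E; (tauto || split; congruence).
Qed.
End Square.

(** Let [D] carry a maximal pairing. If [D] embeds in its complement, the pairing extends, against
    maximality. Otherwise the complement embeds in [D], hence so does all of [T], and the pairing
    pulls back. *)
Lemma square_injection (T : Type) :
  infinite_set [set: T] -> exists f : T * T -> T, injective f.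
Proof.
elim/Ppointed: T => [T|T /infiniteP/pcard_injP[g ginj]].
  by rewrite emptyE => /(_ (finite_set0 _)).
have {}ginj : injective g by move=> m n; apply: ginj; rewrite inE.
(* The union of the empty chain must satisfy [P], so only nonempty graphs are required to have [g]
   in their domain. *)
pose P (G : set (T * T * T)) := is_pairing_graph G /\
  (G !=set0 -> forall n, diagonal_domain G (g n)).
have [F FP Ftot|G [[Gpair Gg] Gmax]] := @Zorn_bigcup _ P.
  split; first by apply: is_pairing_graph_bigcup Ftot => G /FP[].
  move=> [x [G FG Gx]] n; have [_ /(_ (ex_intro _ x Gx) n)] := FP _ FG.
  by move=> [c Gc]; exists c; exists G.
have {}Gg : forall n, diagonal_domain G (g n).
  apply: Gg; apply/set0P/eqP => G0.
  (* A pairing of [nat] carried over to the range of [g] properly extends the empty graph, so a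
     maximal graph is nonempty. *)
  have [e eP] : exists e : T -> T -> T,
      forall m n, e (g m) (g n) = g (pickle (m, n)).
    pose g' x := xget 0 [set n | g n = x].
    have g'K n : g' (g n) = n.
      by apply: ginj; rewrite /g'; case: xgetP => [m _ //|/(_ n)/(_ erefl)].
    by exists (fun x y => g (pickle (g' x, g' y))) => m n; rewrite !g'K.
  apply: (Gmax (pairing_graph (range g) e)).
    rewrite G0; split=> // sub.
    apply: (sub ((g 0, g 0), e (g 0) (g 0))).
    by split=> //=; exists 0.
  split=> [|_ n]; last by rewrite diagonal_domain_graph; exists n.
  apply: pairing_graphP; split=> [_ _ [m _ <-] [n _ <-]|].
    by rewrite eP; exists (pickle (m, n)).
  move=> _ _ _ _ [m _ <-] [n _ <-] [m' _ <-] [n' _ <-].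
  by rewrite !eP => /ginj/(pcan_inj pickleK)[-> ->].
have [f fpair GE] := is_pairing_graph_fun Gpair.
move: Gg GE fpair; set D := diagonal_domain G => Gg GE fpair.
have [/pcard_leP|/pcard_leP] := card_le_total D (~` D).
  move=> /injfunPex[h hD hinj].
  have tinj : injective (fun i : 'I_3 => g i) by move=> i j /ginj/val_inj.
  have [f' [f'pair f'E]] :=
    pairing_on_extend fpair tinj (fun i => Gg i) hD hinj.
  exfalso; apply: (Gmax (pairing_graph (D `|` h @` D) f')).
    rewrite GE; split=> [[[a b] c] [/= Da Db ->]|sub].
      by split=> /=; [left|left|rewrite f'E].
    have Dh : (D `|` h @` D) (h (g 0)) by right; exists (g 0).
    apply: (hD _ (Gg 0)).
    suff: pairing_graph D f ((h (g 0), h (g 0)), f' (h (g 0)) (h (g 0))) by case.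
    by apply: sub; split.
  split=> [|_ n]; first exact: pairing_graphP.
  by rewrite diagonal_domain_graph; left.
move=> /injfunPex[k kD kinj]; have [Df finj] := fpair.
(* The distinct tags [g 0] and [g 1] keep the images of [D] and of its complement apart. *)
pose u x := if `[< D x >] then f (g 0) x else f (g 1) (k x).
have Du x : D (u x).
  by rewrite /u; case: asboolP => Dx; apply: Df => //; apply: kD.
have uinj : injective u.
  move=> x y; rewrite /u; case: asboolP => Dx; case: asboolP => Dy.
  - by move=> /finj[].
  - by move=> /finj[]//; [exact: kD|move=> /ginj].
  - by move=> /finj[]//; [exact: kD|move=> /ginj].
  - move=> /finj[]//; [exact: kD|exact: kD|move=> _ /kinj]; rewrite !inE.
    by apply.
exists (fun p => f (u p.1) (u p.2)) => -[a b] [a' b'] /= /finj[]//.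
by move=> /uinj-> /uinj->.
Qed.

(** Iterated pairing separates sequences of equal length; pairing the result with the length
    separates all of them. *)
Lemma seq_injection (T : Type) :
  infinite_set [set: T] -> exists f : seq T -> T, injective f.
Proof.
move=> Tinf; have [p pinj] := square_injection Tinf.
elim/Ppointed: T => [T|T] in Tinf p pinj *.
  by move: Tinf; rewrite emptyE => /(_ (finite_set0 _)).
have /infiniteP/pcard_injP[g ginj] := Tinf.
have {}ginj : injective g by move=> m n; apply: ginj; rewrite inE.
pose e := foldr (fun x y => p (x, y)) (g 0).
have einj s s' : size s = size s' -> e s = e s' -> s = s'.
  elim: s s' => [|x s IHs] [|x' s']//= [/IHs{}IHs] /pinj[-> /IHs->//].
exists (fun s => p (g (size s), e s)) => s s' /pinj[/ginj ss' ee'].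
exact: einj.
Qed.

(** * Jumps in chains of closed sets *)

Section ClosedChains.
Variables (P K : Type) (st : P -> K -> bool).

(** With [st a k] as the answer at [a] to the atomic question [k], the points [b] agreeing with [a]
    on [s] form a basic neighbourhood of [a]. *)
Definition agree (a b : P) (s : seq K) : bool :=
  all (fun k => st b k == st a k) s.

Definition locally_constant (Q : P -> Prop) : Prop :=
  forall a, exists s, forall b, agree a b s -> (Q b <-> Q a).

Definition finitely_closed (X : set P) : Prop :=
  forall a, ~ X a -> exists s, forall b, agree a b s -> ~ X b.

(* A jump [X `<` Y] is coded by a basic neighbourhood of a point of [Y] that
   avoids [X].  Two jumps of a chain with the same code have the same lower
   set, since a larger lower set would contain the chosen point. *)
Lemma jumps_finitely_closed (C : set (set P)) :
  C `<=` finitely_closed -> total_on C subset ->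
  exists g : set P * set P -> seq (K * bool), {in jumps C &, injective g}.
Proof.
move=> Cclosed Ctot.
pose nb (c : seq (K * bool)) b := all (fun kc => st b kc.1 == kc.2) c.
have [g gP] : {g : set P * set P -> seq (K * bool) & forall XY, jumps C XY ->
    (exists2 a, XY.2 a & nb (g XY) a) /\ (forall b, nb (g XY) b -> ~ XY.1 b)}.
  apply: (@choice _ _ (fun XY c => jumps C XY ->
    (exists2 a, XY.2 a & nb c a) /\ (forall b, nb c b -> ~ XY.1 b))) => -[X Y].
  have [[/= CX CY [_ YX] _]|NJ] := pselect (jumps C (X, Y));
    last by exists [::] => /NJ.
  have [a /not_implyP[Ya NXa]] := (existsNP _).2 YX.
  have [s sP] := Cclosed _ CX _ NXa.
  exists [seq (k, st a k) | k <- s] => _; split=> [|b].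
    by exists a => //; rewrite /nb all_map; apply/allT => k /=.
  by rewrite /nb all_map => /sP.
exists g; suff low XY XY' : jumps C XY -> jumps C XY' -> g XY = g XY' ->
    XY.1 `<=` XY'.1.
  (* The lower set of a jump determines the upper one: of two different upper sets, the smaller
     would lie inside the other jump. *)
  have up X Y Y' : jumps C (X, Y) -> jumps C (X, Y') -> Y `<=` Y'.
    move=> [/= CX CY XY between] [/= _ CY' XY' _].
    have [//|Y'Y] := Ctot _ _ CY CY'.
    by apply: contrapT => NYY'; apply: between; exists Y'.
  move=> [X Y] [X' Y'] /set_mem JXY /set_mem JXY' gE.
  have XX' : X = X'.
    by apply/seteqP; split; [apply: low JXY JXY' _|apply: low JXY' JXY _].
  move: JXY'; rewrite -XX' => JXY'; congr pair.
  by apply/seteqP; split; [apply: up JXY JXY'|apply: up JXY' JXY].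
move=> JXY JXY' gE.
have [_ gN] := gP _ JXY; have [[a Ya ga] _] := gP _ JXY'.
move: XY XY' => [X Y] [X' Y'] /= in JXY JXY' gE gN Ya ga *.
have [CX CY [XY _] _] := JXY; have [CX' CY' _ between] := JXY'.
(* If [X'] is strictly below [X], the jump from [X'] to [Y'] forces [Y'] into [X], so [X] contains
   [a], which the common code excludes. *)
have [//|X'X] := Ctot _ _ CX CX'; apply: contrapT => XX'; rewrite -gE in ga.
apply: (gN _ ga); have [/(_ _ Ya)//|XY'] := Ctot _ _ CY' CX.
apply: contrapT => NXa; apply: between; exists X; split=> //.
by split=> // Y'X; apply/NXa/Y'X.
Qed.
End ClosedChains.

(** * Permutations as relations *)

Section RelSym.
Variable Omega : Type.
Implicit Types (s : Sym Omega) (y z : Rel Omega) (p q r : Omega).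

Lemma rel_of_sym_mull s z q r p : rel_of_sym s (q, r) ->
  (rel_of_sym s * z)%g (q, p) <-> z (r, p).
Proof.
move=> /= qE; split; last by exists r.
by move=> [r' [/= qE' zr'p]]; rewrite -(sym_funK s r) -qE [q]qE' sym_funK.
Qed.

Lemma rel_of_sym_mulr s z q r p : rel_of_sym s (r, p) ->
  (z * rel_of_sym s)%g (q, p) <-> z (q, r).
Proof.
move=> rE; split; last by exists r.
by move=> [r' [zqr' r'E]]; rewrite [r]rE -[sym_fun _ _]r'E.
Qed.

Variables (G : groupType) (h : G -> Rel Omega).
Hypothesis h_morph : monoid_morphism h.

Lemma group_image_sym g : exists s, h g = rel_of_sym s.
Proof.
have hV : (h g * h g^-1 = 1)%g by rewrite -h_morph.2 mulgV h_morph.1.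
have Vh : (h g^-1 * h g = 1)%g by rewrite -h_morph.2 mulVg h_morph.1.
have : range (@uval (Rel Omega)) (h g) by exists (MkUnits hV Vh).
by rewrite -rel_of_sym_units => -[s _ <-]; exists s.
Qed.

(** The inverse of a permutation is its converse relation, so questions about an inverted variable
    are questions about the variable. *)
Lemma group_image_inv g q p : h g^-1 (q, p) <-> h g (p, q).
Proof.
have inv g' q' p' : h g'^-1 (q', p') -> h g' (p', q').
  have [s sE] := group_image_sym g'; rewrite sE => hq'p'.
  have : (h g' * h g'^-1)%g (s q', p') by exists q'; rewrite sE.
  by rewrite -h_morph.2 mulgV h_morph.1; apply: esym.
by split=> [|hpq]; [exact: inv|apply: inv; rewrite invgK].
Qed.
End RelSym.

(** * Solution sets are closed *)

Section Solutions.
Variables (Omega J A P K : Type) (G : groupType) (M : monoidType).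
Variables (i : G -> M) (f : M -> Rel Omega).
Variables (x : P -> J -> G) (v : P -> A -> M) (st : P -> K -> bool).
Hypotheses (i_morph : monoid_morphism i) (f_morph : monoid_morphism f).
Hypothesis f_inj : injective f.
Hypothesis x_local :
  forall j q p, locally_constant st (fun a => f (i (x a j)) (q, p)).
Hypothesis v_local :
  forall m q p, locally_constant st (fun a => f (v a m) (q, p)).

Let letter_rel a l := f (eval_letter i (x a) (v a) l).
Let word_rel a w := f (eval_word i (x a) (v a) w).

Let fi_morph : monoid_morphism (f \o i).
Proof.
split=> [|g g'] /=; first by rewrite i_morph.1 f_morph.1.
by rewrite i_morph.2 f_morph.2.
Qed.

Let word_rel_cons a l w : word_rel a (l :: w) = (letter_rel a l * word_rel a w)%g.
Proof. exact: f_morph.2. Qed.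

Lemma letter_locally_constant l q p :
  locally_constant st (fun a => letter_rel a l (q, p)).
Proof.
have inv g q' p' : f (i g^-1%g) (q', p') <-> f (i g) (p', q').
  exact: (group_image_inv fi_morph).
case: l => [j|j|c|c|m] a; rewrite /letter_rel /=.
- exact: x_local.
- by have [s sP] := x_local j p q a; exists s => b /sP; rewrite !inv.
- by exists [::].
- by exists [::].
- exact: v_local.
Qed.

Lemma letter_sym a l : ~~ is_MSym l -> exists s, letter_rel a l = rel_of_sym s.
Proof. by case: l => //= c _; apply: (group_image_sym fi_morph). Qed.

Lemma word_sym a w : ~~ has (@is_MSym J G A) w ->
  exists s, word_rel a w = rel_of_sym s.
Proof.
elim: w => [_|l w IHw /= /norP[Nl /IHw[t tE]]].
  exists 1%g; rewrite (rel_of_sym_morphism Omega).1; exact: f_morph.1.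
have [s sE] := letter_sym a Nl; exists (s * t)%g.
by rewrite word_rel_cons sE tE (rel_of_sym_morphism Omega).2.
Qed.

Lemma word_locally_constant w q p : (count (@is_MSym J G A) w <= 1)%N ->
  locally_constant st (fun a => word_rel a w (q, p)).
Proof.
move=> + a; elim: w q => [|l w IHw] q; first by exists [::].
rewrite /=; have [Ml|Nl] := boolP (is_MSym l).
  rewrite add1n ltnS leqn0 => /eqP w0.
  have Nw : ~~ has (@is_MSym J G A) w by rewrite has_count w0.
  have [t tE] := word_sym a Nw.
  (* The tail is a permutation, so [t p] is the only possible intermediate point at [a]; fixing the
     pair [(t p, p)] keeps it so at every nearby [b]. *)
  have [|s sP] := IHw (t p); first by rewrite w0.
  have [s' s'P] := letter_locally_constant l q (t p) a.
  exists (s ++ s') => b; rewrite /agree all_cat => /andP[/sP wb /s'P lb].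
  have wa : word_rel a w (t p, p) by rewrite tE.
  have [u uE] := word_sym b Nw.
  rewrite !word_rel_cons tE uE (@rel_of_sym_mulr _ _ _ _ (t p)); last first.
    by rewrite -uE; apply/wb.
  by rewrite (@rel_of_sym_mulr _ _ _ _ (t p)).
rewrite add0n => w1; have [t tE] := letter_sym a Nl.
(* Symmetrically, an invertible first letter leads from [q] to [r] alone, at [a] and at every [b]
   that keeps the pair [(q, r)]. *)
pose r := sym_inv t q.
have la : letter_rel a l (q, r) by rewrite tE; exact/esym/(sym_funVK t q).
have [s sP] := IHw r w1; have [s' s'P] := letter_locally_constant l q r a.
exists (s ++ s') => b; rewrite /agree all_cat => /andP[/sP wb /s'P lb].
have [u uE] := letter_sym b Nl.
rewrite !word_rel_cons tE uE (@rel_of_sym_mull _ _ _ _ r); last first.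
  by rewrite -uE; apply/lb.
by rewrite (@rel_of_sym_mull _ _ _ _ r) // -tE.
Qed.

Lemma solutions_finitely_closed (S : set (equation J G A)) :
  (forall e, S e -> MSym_at_most_once e) ->
  finitely_closed st [set a | satisfies i (x a) (v a) S].
Proof.
move=> S1 a /existsNP[[w w'] /not_implyP[Se /= ww']].
have [w1 w'1] := S1 _ Se.
(* Since [f] is injective, a failing equation already fails at one pair, and finitely many atoms
   preserve that failure. *)
have [[q p] qpP] : exists qp, ~ (word_rel a w qp <-> word_rel a w' qp).
  apply: contrapT => /forallNP ee; apply/ww'/f_inj/seteqP.
  by split=> qp; have /contrapT[] := ee qp.
have [s sP] := word_locally_constant q p w1 a.
have [s' s'P] := word_locally_constant q p w'1 a.
exists (s ++ s') => b; rewrite /agree all_cat => /andP[/sP wb /s'P w'b].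
by move=> /(_ _ Se)/= eb; apply: qpP; rewrite -wb -w'b /word_rel eb.
Qed.
End Solutions.

(** * Counting the basic open sets *)

(** Covers both halves of the theorem: [f] is the identity for [Rel Omega] and the given embedding
    for a general [M]. *)
Lemma lattices_no_chain_with_more_jumps (Omega J : Type) (G : groupType)
    (M : monoidType) (i : G -> M) (f : M -> Rel Omega) :
  infinite_set [set: Omega] -> [set: J] #<= [set: Omega] ->
  monoid_morphism i -> monoid_morphism f -> injective f ->
  no_chain_with_more_jumps Omega (lattice_L J i) /\
  no_chain_with_more_jumps Omega (lattice_L' J i).
Proof.
move=> Oinf JO i_morph f_morph f_inj.
have [e einj] := seq_injection Oinf.
have [ij ijinj] : exists ij : J -> Omega, injective ij.
  elim/Ppointed: Omega => [Omega|Omega] in Oinf JO {f f_morph f_inj e einj} *.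
    by move: Oinf; rewrite emptyE => /(_ (finite_set0 _)).
  by have /pcard_injP[ij ijinj] := JO; exists ij => j j'; apply: ijinj; rewrite inE.
pose K := (J * (Omega * Omega) + Omega * Omega)%type.
(* The lengths 3 and 2 separate the two kinds of atoms; below, repeating a code once or twice
   records the boolean. *)
pose codeK (k : K) := e (match k with
  | inl (j, (q, p)) => [:: ij j; q; p] | inr (q, p) => [:: q; p] end).
have codeK_inj : injective codeK.
  move=> [[j [q p]]|[q p]] [[j' [q' p']]|[q' p']] /einj[] //.
    by move=> /ijinj-> -> ->.
  by move=> -> ->.
pose codeKb (kb : K * bool) := e (nseq kb.2.+1 (codeK kb.1)).
have codeKb_inj : injective codeKb.
  by move=> [k []] [k' []] /einj[] // /codeK_inj->.
have codes_inj : injective (e \o map codeKb).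
  exact: inj_comp einj (inj_map codeKb_inj).
have bound P (st : P -> K -> bool) C : C `<=` finitely_closed st ->
    total_on C subset -> jumps C #<= [set: Omega].
  move=> Cclosed Ctot; have [g ginj] := jumps_finitely_closed Cclosed Ctot.
  have /injfunPex[] : exists2 g' : set P * set P -> Omega,
      set_fun (jumps C) setT g' & set_inj (jumps C) g'.
    exists (e \o map codeKb \o g) => // X Y JX JY /= XY.
    by apply: ginj => //; apply: codes_inj.
  exact: inj_card_le.
split=> C [CL Ctot].
  pose st (a : (J -> G) * M) (k : K) := match k with
    | inl (j, qp) => `[< f (i (a.1 j)) qp >] | inr qp => `[< f a.2 qp >] end.
  apply: (bound _ st _ _ Ctot) => X /CL[S [S1 ->]].
  apply: (@solutions_finitely_closed _ _ _ _ _ _ _ i f fst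
    (fun a _ => a.2)) => //.
  - move=> j q p a; exists [:: inl (j, (q, p))] => b /andP[/eqP+ _]; exact: asbool_eq_equiv.
  - move=> _ q p a; exists [:: inr (q, p)] => b /andP[/eqP+ _]; exact: asbool_eq_equiv.
(* Points now have no [M]-coordinate, so the [inr] atoms get the constant answer [true]; [M]-valued
   constants do not vary with the point. *)
pose st (a : J -> G) (k : K) :=
  if k is inl (j, qp) then `[< f (i (a j)) qp >] else true.
apply: (bound _ st _ _ Ctot) => X /CL[S [S1 ->]].
apply: (@solutions_finitely_closed _ _ _ _ _ _ _ i f id (fun _ => id)) => //.
- move=> j q p a; exists [:: inl (j, (q, p))] => b /andP[/eqP+ _]; exact: asbool_eq_equiv.
- by move=> m q p a; exists [::].
Qed.

Theorem theorem7p6 (Omega J : Type) (Omega_infinite : infinite_set [set: Omega])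
    (J_le_Omega : [set: J] #<= [set: Omega]) :
  (no_chain_with_more_jumps Omega (lattice_L J (@rel_of_sym Omega)) /\
   no_chain_with_more_jumps Omega (lattice_L' J (@rel_of_sym Omega))) /\
  (forall M : monoidType, embeddable M (Rel Omega) ->
   no_chain_with_more_jumps Omega (lattice_L J (@uval M)) /\
   no_chain_with_more_jumps Omega (lattice_L' J (@uval M))).
Proof.
split=> [|M [f [f_inj f_morph]]].
  apply: (lattices_no_chain_with_more_jumps (f := id)) => //.
  exact: rel_of_sym_morphism.
exact: (lattices_no_chain_with_more_jumps (f := f)).
Qed.
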